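(* Let $n\ge1$ and let $m=m^{(n)}=(m_1,\dots,m_n)\in\mathbb{R}^n$. Then $m$ is realizable on $\mathbb{N}_0$ if and only if both of the following conditions hold: (1) $L_P(m)\ge 0$ for every $P\in\mathcal{P}_n$; (2) for every $P\in\mathcal{P}_{n-1}$: $L_P(m)\ge 0$, and if $L_P(m)=0$ then $L_{\widehat P}(m)=0$, where $\widehat P(x)=xP(x)$.
   Context: $\mathbb{N}_0=\{0,1,2,\dots\}$. A moment vector $m=(m_1,\dots,m_n)$ is an $n$-tuple of real numbers; by convention $m_0=1$. It is realizable on $\mathbb{N}_0$ if there is a probability measure $\mu$ on $\mathbb{N}_0$ with $\int x^k\,d\mu(x)=m_k$ for $k=1,\dots,n$. For a polynomial $P(x)=\sum_{k=0}^n p_kx^k$ of degree at most $n$, $L_P(m)=\sum_{k=0}^n p_km_k$. For $k\ge 0$, $\mathcal{P}_k$ denotes the set of monic polynomials of degree $k$ which have $k$ distinct roots in $\mathbb{N}_0$ and are nonnegative on $\mathbb{N}_0$ (so $\mathcal{P}_0=\{1\}$). *)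

(* Defs.v *)
From HB Require Import structures.
From mathcomp Require Import all_boot all_order all_algebra.
From mathcomp Require Import all_classical all_reals all_analysis.
Set Implicit Arguments. Unset Strict Implicit. Unset Printing Implicit Defensive.
Import Order.TTheory GRing.Theory Num.Theory.
Local Open Scope ring_scope.

(* The tuple is 0-indexed: its entry [tnth m i] is the moment of order [i.+1];
   [moment m k] is m_k, with the convention m_0 = 1. *)
Definition moment (R : realType) (n : nat) (m : n.-tuple R) (k : nat) : R :=
  (1 :: m)`_k.

(* The integrands are nonnegative, so the equalities with finite values force
   integrability. Every subset of [nat] is measurable. *)
Definition realizable (R : realType) (n : nat) (m : n.-tuple R) : Prop :=
  exists mu : probability nat R,
    forall k : nat, (1 <= k <= n)%N ->
      (\int[mu]_(x in [set: nat]) ((x%:R : R) ^+ k)%:E)%E = (moment m k)%:E.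

(* Meaningful for polynomials of degree at most n, i.e. of size at most n.+1. *)
Definition momentL (R : realType) (n : nat) (P : {poly R}) (m : n.-tuple R) : R :=
  \sum_(k < n.+1) P`_k * moment m k.

Definition calP (R : realType) (k : nat) (P : {poly R}) : Prop :=
  [/\ P \is monic,
      size P = k.+1,
      exists s : seq nat,
        [/\ uniq s, size s = k & all (fun j : nat => root P j%:R) s]
    & forall x : nat, 0 <= P.[x%:R]].

Definition hatpoly (R : realType) (P : {poly R}) : {poly R} := 'X * P.

(* Main.v *)
Require Import Defs.
From HB Require Import structures.
From mathcomp Require Import all_boot all_order all_algebra.
From mathcomp Require Import all_classical all_reals all_analysis.
From mathcomp Require Import ring lra zify.
Import Order.TTheory GRing.Theory Num.Theory.
Local Open Scope ring_scope.

(* Necessity: [L_P] is the integral of [P]; if it vanishes, the measure is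
   carried by the roots of [P], hence [x P] integrates to 0 as well.
   Sufficiency goes by induction on [n]: the conditions for [n+1] imply those
   for [n], so [L] is a finite positive combination of evaluations in degree
   [<= n].  Among the [P] in [P_(n+1)] choose one with the least value
   [c = L_P >= 0] and, among these, with the least sum of roots.  For a root [i]
   of [P], put [R = P / (x - i)]; if the first integer [t] beyond [i], on the
   side where [R] has the wrong sign, with [R(t) <> 0] exists, then [R (x - t)]
   is again in [P_(n+1)], and minimality gives [L_R <= 0] when [R(i) < 0] and
   [L_R > 0] when [R(i) > 0].  If no such [t] exists, [R] is in [P_n] and
   condition (2) gives [L_R > 0], or [L_R = c = 0].  By these signs, Lagrange
   interpolation at the roots of [P] and one very large integer [N] writes [L]
   with nonnegative weights: the atom at [N] absorbs [c]. *)

(** * Products of linear factors with natural roots *)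

Section RootPolynomials.
Context {R : archiRealFieldType}.
Implicit Types (s r : seq nat) (x y t : nat).

Definition rootpoly s : {poly R} := \prod_(j <- s) ('X - (j%:R)%:P).

Lemma rootpoly_cons j s : rootpoly (j :: s) = ('X - (j%:R)%:P) * rootpoly s.
Proof. by rewrite /rootpoly big_cons. Qed.

Lemma perm_rootpoly s r : perm_eq s r -> rootpoly s = rootpoly r.
Proof. by move=> ?; apply: perm_big. Qed.

Lemma size_rootpoly s : size (rootpoly s) = (size s).+1.
Proof. exact: size_prod_XsubC. Qed.

Lemma monic_rootpoly s : rootpoly s \is monic.
Proof. exact: monic_prod_XsubC. Qed.

Lemma horner_rootpoly_cons j s (x : R) :
  (rootpoly (j :: s)).[x] = (x - j%:R) * (rootpoly s).[x].
Proof. by rewrite rootpoly_cons hornerM hornerXsubC. Qed.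

Lemma horner_rootpoly s (x : R) :
  (rootpoly s).[x] = \prod_(j <- s) (x - j%:R).
Proof. by rewrite horner_prod; apply: eq_bigr => j _; rewrite hornerXsubC. Qed.

Lemma rootpoly_eq0 s x : ((rootpoly s).[x%:R] == 0) = (x \in s).
Proof.
rewrite horner_rootpoly prodf_seq_eq0 -has_pred1 /=.
by apply: eq_has => j /=; rewrite subr_eq0 eqr_nat eq_sym.
Qed.

Lemma rootpoly_mem s x : x \in s -> (rootpoly s).[x%:R] = 0.
Proof. by rewrite -rootpoly_eq0 => /eqP. Qed.

(** Root lists of the members of [calP], see [calPE]; on lists, roots can be removed, exchanged and
    summed. *)
Definition admissible s := uniq s /\ forall x, 0 <= (rootpoly s).[x%:R].

Lemma perm_admissible s r : perm_eq s r -> admissible s -> admissible r.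
Proof.
by move=> sr [us ns]; split; rewrite -?(perm_uniq sr) -?(perm_rootpoly _ _ sr).
Qed.

Lemma admissible_natval s x : admissible s -> (rootpoly s).[x%:R] \is a Num.nat.
Proof.
case=> _ ns; rewrite natrEint ns andbT horner_rootpoly.
by apply: rpred_prod => j _; rewrite rpredB ?rpred_nat.
Qed.

Lemma notin_sumn s x : (sumn s < x)%N -> x \notin s.
Proof.
elim: s => //= j s ih lx; rewrite inE negb_or ih ?andbT; last by lia.
by lia.
Qed.

Lemma rootpoly_sumn_gt0 s x : (sumn s < x)%N -> 0 < (rootpoly s).[x%:R].
Proof.
elim: s => [|j s ih] /= lx; first by rewrite /rootpoly big_nil hornerC.
rewrite horner_rootpoly_cons mulr_gt0 ?ih //; last by lia.
by rewrite subr_gt0 ltr_nat; lia.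
Qed.

Lemma admissible_iota k : admissible (iota 0 k).
Proof.
split=> [|x]; first exact: iota_uniq.
case: (ltnP x k) => kx.
  by rewrite rootpoly_mem // mem_iota.
rewrite horner_rootpoly big_seq prodr_ge0 // => j; rewrite mem_iota => /andP[_ jk].
by rewrite subr_ge0 ler_nat; lia.
Qed.

(** No integer lies strictly between [k] and [k.+1], so the two new factors have a nonnegative
    product. *)
Lemma admissible_add2 r k : admissible r -> (sumn r < k)%N ->
  admissible [:: k, k.+1 & r].
Proof.
move=> [ur nr] rk; split.
  by rewrite /= inE negb_or ur !notin_sumn //; lia.
move=> x; rewrite !horner_rootpoly_cons mulrA mulr_ge0 //.
have [xk|kx] := leqP x k.
  by rewrite mulr_le0 // subr_le0 ler_nat; lia.
by rewrite mulr_ge0 // subr_ge0 ler_nat; lia.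
Qed.

(** For [t] the least non-root, [rootpoly r] vanishes below [t] and the new factor is nonnegative
    from [t] on. *)
Lemma admissible_add_least r : admissible r -> exists t, admissible (t :: r).
Proof.
move=> [ur nr].
have ext : exists t, t \notin r by exists (sumn r).+1; exact: notin_sumn.
exists (ex_minn ext); case: ex_minnP => t tr tmin; split; first by rewrite /= tr.
move=> x; rewrite horner_rootpoly_cons; have [xt|tx] := ltnP x t.
  have /eqP -> : (rootpoly r).[x%:R] == 0.
    by rewrite rootpoly_eq0; apply: contraLR xt => /tmin; rewrite leqNgt.
  by rewrite mulr0.
by rewrite mulr_ge0 // subr_ge0 ler_nat.
Qed.

Section Exchange.
Variables (i : nat) (r : seq nat).
Hypothesis adm : admissible (i :: r).

Let nonneg x : 0 <= (x%:R - i%:R) * (rootpoly r).[x%:R].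
Proof. by rewrite -horner_rootpoly_cons; case: adm. Qed.

Let neg_below x : (x < i)%N -> (rootpoly r).[x%:R] <= 0.
Proof.
by move=> xi; rewrite -(nmulr_rge0 _ (_ : x%:R - i%:R < 0)) ?subr_lt0 ?ltr_nat.
Qed.

Let pos_above x : (i < x)%N -> 0 <= (rootpoly r).[x%:R].
Proof.
by move=> xi; rewrite -(pmulr_rge0 _ (_ : 0 < x%:R - i%:R)) ?subr_gt0 ?ltr_nat.
Qed.

Let uniq_r : uniq r. Proof. by case: adm => /andP[]. Qed.

(** Take for [t] the least non-root above [i]: [rootpoly r] vanishes strictly between; up to [i]
    both factors are nonpositive, from [t] on both are nonnegative. *)
Lemma exchange_up : (rootpoly r).[i%:R] < 0 ->
  exists2 t, (i < t)%N & admissible (t :: r).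
Proof.
move=> ri.
have ext : exists t, (i < t)%N && (t \notin r).
  by exists (sumn r + i).+1; rewrite notin_sumn ?andbT; lia.
exists (ex_minn ext); case: ex_minnP => t /andP[it tr] tmin //.
split=> [|x]; first by rewrite /= tr.
rewrite horner_rootpoly_cons; have [xt|tx] := ltnP x t; last first.
  by rewrite mulr_ge0 ?subr_ge0 ?ler_nat // pos_above; lia.
have [ix|] := ltnP i x.
  have /eqP -> : (rootpoly r).[x%:R] == 0.
    by rewrite rootpoly_eq0; apply: contraLR xt => xr; rewrite -leqNgt tmin ?ix.
  by rewrite mulr0.
rewrite leq_eqVlt => /orP[/eqP xi|xi].
  by rewrite xi mulr_le0 ?(ltW ri) // subr_le0 ler_nat ltnW.
by rewrite mulr_le0 ?neg_below // subr_le0 ler_nat ltnW.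
Qed.

(** Downward, there may be no non-root below [i]; then [rootpoly r] vanishes below [i] and is
    nonnegative from [i] on. *)
Lemma exchange_down : 0 < (rootpoly r).[i%:R] ->
  (exists2 t, (t < i)%N & admissible (t :: r)) \/ admissible r.
Proof.
move=> ri.
have [ext|noext] := pselect (exists t, (t < i)%N && (t \notin r)); [left|right].
  have ub t : (t < i)%N && (t \notin r) -> (t <= i)%N by case/andP=> /ltnW.
  exists (ex_maxn ext ub); case: ex_maxnP => t /andP[ti tr] tmax //.
  split=> [|x]; first by rewrite /= tr.
  rewrite horner_rootpoly_cons; have [xt|tx] := leqP x t.
    by rewrite mulr_le0 ?neg_below ?subr_le0 ?ler_nat //; lia.
  have [xi|] := ltnP x i.
    have /eqP -> : (rootpoly r).[x%:R] == 0.
      by rewrite rootpoly_eq0; apply: contraLR tx => xr; rewrite -leqNgt tmax ?xi.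
    by rewrite mulr0.
  rewrite leq_eqVlt => /orP[/eqP <-|ix].
    by rewrite mulr_ge0 ?(ltW ri) // subr_ge0 ler_nat ltnW.
  by rewrite mulr_ge0 ?pos_above // subr_ge0 ler_nat ltnW.
split=> // x; have [xi|] := ltnP x i.
  suff /eqP -> : (rootpoly r).[x%:R] == 0 by [].
  rewrite rootpoly_eq0; apply: contrapT => /negP xr; apply: noext.
  by exists x; rewrite xi.
by rewrite leq_eqVlt => /orP[/eqP <-|/pos_above //]; exact: ltW.
Qed.

End Exchange.

Lemma lagrange s (f : {poly R}) : uniq s -> (size f <= size s)%N ->
  f = \sum_(y <- s) (f.[y%:R] / (rootpoly (rem y s)).[y%:R]) *: rootpoly (rem y s).
Proof.
move=> us sf; apply/eqP; rewrite -subr_eq0; apply/eqP.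
apply: (@roots_geq_poly_eq0 _ _ [seq y%:R | y <- s]).
- apply/allP => _ /mapP[x xs ->]; rewrite /root !hornerE horner_sum.
  rewrite (bigD1_seq x) //= big1_seq => [|y /andP[yx ys]].
    rewrite addr0 hornerZ divfK ?subrr // rootpoly_eq0.
    by rewrite (mem_rem_uniq x us) inE eqxx.
  by rewrite hornerZ (rootpoly_mem (rem y s) x) ?mulr0 // (mem_rem_uniq y us) inE eq_sym yx.
- by rewrite map_inj_uniq // => x y /eqP; rewrite eqr_nat => /eqP.
rewrite size_map (leq_trans (size_polyD _ _)) // geq_max sf size_polyN /=.
rewrite big_seq; apply: (leq_trans (size_sum _ _ _)).
apply/bigmax_leqP_seq => y ys _; apply: leq_trans (size_scale_leq _ _) _.
by rewrite size_rootpoly size_rem // prednK //; case: (s) ys.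
Qed.

End RootPolynomials.

(** * Attained minima *)

Section Minima.
Context {R : realDomainType} {T : Type}.
Implicit Types (F : T -> R) (v : T -> nat) (A : T -> Prop).

(** Equivalently, the values of [F] are well-ordered; asking for a minimum on every [A] is what lets
    terms be added one by one. *)
Definition has_minima F := forall A, (exists x, A x) ->
  exists2 x, A x & forall y, A y -> F x <= F y.

Lemma has_minima_cst c : has_minima (fun=> c).
Proof. by move=> A [x Ax]; exists x. Qed.

Lemma has_minima_add F v w : 0 <= w -> has_minima F ->
  has_minima (fun x => F x + w * (v x)%:R).
Proof.
move=> w0 Fm.
(* A minimizer [x] of [F] beats every [y] with [v x <= v y], which leaves only
   the finitely many smaller values of [v]. *)
have step A x : A x -> (forall y, A y -> F x <= F y) ->
    ((exists y, A y /\ (v y < v x)%N) ->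
      exists2 z, A z /\ (v z < v x)%N & forall y, A y /\ (v y < v x)%N ->
        F z + w * (v z)%:R <= F y + w * (v y)%:R) ->
    exists2 z, A z & forall y, A y -> F z + w * (v z)%:R <= F y + w * (v y)%:R.
  move=> Ax xmin small.
  have big y : A y -> (v x <= v y)%N -> F x + w * (v x)%:R <= F y + w * (v y)%:R.
    by move=> Ay xy; rewrite lerD ?xmin // ler_wpM2l // ler_nat.
  have [/small[z [Az _] zmin]|none] := pselect (exists y, A y /\ (v y < v x)%N).
    have [xz|/ltW zx] := leP (F x + w * (v x)%:R) (F z + w * (v z)%:R).
      exists x => // y Ay; have [xy|yx] := leqP (v x) (v y); first exact: big.
      exact: le_trans xz (zmin y (conj Ay yx)).
    exists z => // y Ay; have [xy|yx] := leqP (v x) (v y); last exact: zmin.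
    exact: le_trans zx (big y Ay xy).
  exists x => // y Ay; apply: big => //; rewrite leqNgt.
  by apply/negP => yx; apply: none; exists y.
(* Induction on [b]: the members with [v y < v x] satisfy the next smaller bound. *)
have bounded b A : (exists x, A x) -> (forall x, A x -> (v x < b)%N) ->
    exists2 x, A x & forall y, A y -> F x + w * (v x)%:R <= F y + w * (v y)%:R.
  elim: b A => [A [x Ax] /(_ x Ax) //|b ih A /Fm[x Ax xmin] vb].
  apply: (step A x) => // ex; apply: ih => // y [_ yx].
  by apply: leq_trans yx _; rewrite -ltnS vb.
move=> A /Fm[x Ax xmin]; apply: (step A x) => // ex.
by apply: (bounded (v x) _ ex) => y [].
Qed.

Lemma has_minima_sum F (I : Type) (r : seq I) (w : I -> R) (u : I -> T -> nat) :
  (forall i, 0 <= w i) -> has_minima F ->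
  has_minima (fun x => F x + \sum_(i <- r) w i * (u i x)%:R).
Proof.
move=> w0; elim: r F => [|i r ih] F Fm.
  by under eq_fun do rewrite big_nil addr0.
under eq_fun do rewrite big_cons addrA.
exact/ih/has_minima_add.
Qed.

Lemma lex_minimum F v A : has_minima F -> (exists x, A x) ->
  exists2 x, A x & forall y, A y ->
    F x <= F y /\ (F y = F x -> (v x <= v y)%N).
Proof.
move=> Fm /Fm[x Ax xmin].
(* With the zero function and weight 1, [has_minima_add] minimizes [v] itself, here among the
   minimizers of [F]. *)
have [|z [Az Fzx] zmin] := has_minima_add (fun=> 0) v 1 ler01
  (has_minima_cst 0) (fun z => A z /\ F z = F x); first by exists x.
exists z => // y Ay; rewrite Fzx; split=> [|Fyx]; first exact: xmin.
by have := zmin y (conj Ay Fyx); rewrite !add0r !mul1r ler_nat.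
Qed.

End Minima.

(** * Finitely atomic representations of a linear functional *)

Section Moments.
Context {R : archiRealFieldType}.
Variable L : {scalar {poly R}}.

Definition moment_conditions n :=
  (forall s, admissible (R := R) s -> size s = n -> 0 <= L (rootpoly s)) /\
  (forall s, admissible (R := R) s -> size s = n.-1 ->
     0 <= L (rootpoly s) /\ (L (rootpoly s) = 0 -> L ('X * rootpoly s) = 0)).

(** A quadrature formula with nonnegative weights, exact up to degree [n]. *)
Definition atomic n := exists (s : seq nat) (w : nat -> R),
  (forall y, 0 <= w y) /\
  forall f : {poly R}, (size f <= n.+1)%N -> L f = \sum_(y <- s) w y * f.[y%:R].

Lemma scalar_rootpoly_cons j s :
  L (rootpoly (j :: s)) = L ('X * rootpoly s) - j%:R * L (rootpoly s).
Proof. by rewrite rootpoly_cons mulrBl raddfB /= mul_polyC linearZ. Qed.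

Lemma quadratic_eventually_ge0 (a b c : R) K :
  (forall k, (K < k)%N -> 0 <= a - (k + k.+1)%:R * b + (k * k.+1)%:R * c) ->
  0 <= c /\ (c = 0 -> b <= 0).
Proof.
have large (x : R) : exists2 k, (K < k)%N & x < k%:R.
  exists (maxn K.+1 (Num.bound `|x|)); first by rewrite leq_maxl.
  apply: le_lt_trans (ler_norm x) (lt_le_trans (archi_boundP (normr_ge0 x)) _).
  by rewrite ler_nat leq_maxr.
move=> H; split=> [|c0]; rewrite leNgt; apply/negP => lt0.
  (* For [k >= 1], [a - (2k+1)b] is at most [k(|a| + 3|b|)], which is below [-c k^2] for this
     [k]. *)
  have [k Kk] := large ((`|a| + 3 * `|b|) / - c).
  rewrite ltr_pdivrMr ?oppr_gt0 // => kc; have := H k Kk.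
  have k1 : 1 <= k%:R :> R by rewrite ler1n; lia.
  rewrite natrD natrM -natr1; have := ler_norm a; have := ler_norm (- b).
  rewrite normrN; have := normr_ge0 a; have := normr_ge0 b.
  move: (k%:R : R) `|a| `|b| k1 kc => t A B *; nra.
have [k Kk] := large (`|a| / b); rewrite ltr_pdivrMr // => kb; have := H k Kk.
rewrite c0 mulr0 addr0 natrD -natr1; have := ler_norm a.
have : 0 <= k%:R :> R by []. 
move: (k%:R : R) `|a| kb => t A *; nra.
Qed.

(** Adjoining the roots [k], [k.+1] to [r] gives a quadratic in [k], nonnegative for all large [k],
    with leading coefficient [L (rootpoly r)]; if that is 0, the linear term forces
    [L ('X * rootpoly r) <= 0]. *)
Lemma moment_conditions_pred n : moment_conditions n.+2 -> moment_conditions n.+1.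
Proof.
move=> [H1 H2]; split=> [s As /H2[]//|r Ar /= sr].
have L2 k : (sumn r < k)%N -> 0 <= L ('X * ('X * rootpoly r))
    - (k + k.+1)%:R * L ('X * rootpoly r) + (k * k.+1)%:R * L (rootpoly r).
  move=> rk; have := H1 _ (admissible_add2 r k Ar rk).
  rewrite /= sr => /(_ erefl); rewrite !scalar_rootpoly_cons rootpoly_cons.
  rewrite mulrCA mulrBl raddfB /= mul_polyC linearZ /= natrD natrM.
  by congr (0 <= _); ring.
have [L0 L1] := quadratic_eventually_ge0 _ _ _ _ L2; split=> // Lr0.
apply/eqP; rewrite eq_le L1 //.
(* Adjoining a single root gives the opposite inequality. *)
have [t At] := admissible_add_least r Ar.
have [|+ _] := H2 _ At; first by rewrite /= sr.
by rewrite scalar_rootpoly_cons Lr0 mulr0 subr0.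
Qed.

(* By induction hypothesis [L (rootpoly s)] is, up to a constant, a combination
   with nonnegative weights of the natural numbers [(rootpoly s).[y]], hence it
   takes a least value although there are infinitely many [s]. *)
Lemma atomic_minimum n (v : seq nat -> nat) : atomic n ->
  exists2 s, admissible (R := R) s /\ size s = n.+1 &
    forall r, admissible (R := R) r /\ size r = n.+1 ->
      L (rootpoly s) <= L (rootpoly r) /\
      (L (rootpoly r) = L (rootpoly s) -> (v s <= v r)%N).
Proof.
move=> [S [w [w0 LS]]].
(* The error of the formula on the leading term ['X^(n.+1)], common to all candidates. *)
pose c := L ('X^(n.+1)) - \sum_(y <- S) w y * y%:R ^+ n.+1.
(* [has_minima_sum] takes natural values; truncation changes nothing on admissible lists. *)
pose F s := c + \sum_(y <- S) w y * (Num.truncn (rootpoly s : {poly R}).[y%:R])%:R.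
have LF s : admissible (R := R) s /\ size s = n.+1 -> L (rootpoly s) = F s.
  case=> As ss; rewrite -[rootpoly s](subrK 'X^(n.+1)) raddfD /= LS.
    rewrite addrC /F /c -addrA; congr (_ + _).
    rewrite addrC -sumrB; apply: eq_bigr => y _.
    by rewrite truncnK ?admissible_natval // !hornerE mulrBr.
  apply/leq_sizeP => j; rewrite coefB coefXn leq_eqVlt => /orP[/eqP <-|nj].
    have /monicP := @monic_rootpoly R s.
    by rewrite /lead_coef size_rootpoly ss => ->; rewrite eqxx subrr.
  by rewrite nth_default ?size_rootpoly ?ss // gtn_eqF // subrr.
have [||s As smin] := @lex_minimum _ _ F v
  (fun s => admissible (R := R) s /\ size s = n.+1).
- exact: has_minima_sum (has_minima_cst c).
- by exists (iota 0 n.+1); rewrite size_iota; split=> //; exact: admissible_iota.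
by exists s => // r Ar; rewrite !LF //; exact: smin.
Qed.

Lemma atomic_succ n : L 1 = 1 -> moment_conditions n.+1 -> atomic n -> atomic n.+1.
Proof.
move=> L1 [H1 H2] /(atomic_minimum _ sumn)[s [As ss] smin].
have us : uniq s by case: As.
pose c := L (rootpoly s); have c0 : 0 <= c by exact: H1.
have perm_s (i : nat) : i \in s -> perm_eq s (i :: rem i s) by exact: perm_to_rem.
have Ladd (i t : nat) : L (rootpoly (t :: rem i s)) =
    L ('X * rootpoly (rem i s)) - t%:R * L (rootpoly (rem i s)).
  exact: scalar_rootpoly_cons.
have LX (i : nat) : i \in s -> L ('X * rootpoly (rem i s)) = c + i%:R * L (rootpoly (rem i s)).
  by move=> /perm_s si; rewrite /c (perm_rootpoly _ _ si) Ladd subrK.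
(* Exchanging [i] for [t] adds [(i - t) * L (rootpoly (rem i s))] to the value of [L] and [t - i] to
   the sum of roots. *)
have smin_rem (i t : nat) : i \in s -> admissible (R := R) (t :: rem i s) ->
    0 <= (i%:R - t%:R) * L (rootpoly (rem i s)) /\
    ((i%:R - t%:R) * L (rootpoly (rem i s)) = 0 -> (i <= t)%N).
  move=> si At.
  have [|] := smin (t :: rem i s).
    by split=> //=; rewrite size_rem // ss.
  rewrite Ladd LX // -/c => le1 le2; split; first by lra.
  move=> e0; have /le2 : c + i%:R * L (rootpoly (rem i s)) -
      t%:R * L (rootpoly (rem i s)) = c by lra.
  by rewrite (perm_sumn (perm_s i si)) /= leq_add2r.
have sign (i : nat) : i \in s ->
    ((rootpoly (rem i s)).[i%:R] < 0 :> R /\ L (rootpoly (rem i s)) <= 0) \/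
    (0 < (rootpoly (rem i s)).[i%:R] :> R /\ 0 <= L (rootpoly (rem i s)) /\
     (L (rootpoly (rem i s)) = 0 -> c = 0)).
  move=> si; have Ai := perm_admissible _ _ (perm_s i si) As.
  have : (rootpoly (rem i s)).[i%:R] != 0 :> R.
    by rewrite rootpoly_eq0 (mem_rem_uniq i us) inE eqxx.
  rewrite neq_lt => /orP[neg|pos]; [left|right]; split=> //.
    have [t it /(smin_rem i t si)[+ _]] := exchange_up _ _ Ai neg.
    have it0 : i%:R - t%:R < 0 :> R by rewrite subr_lt0 ltr_nat.
    by rewrite nmulr_rge0.
  (* If [L (rootpoly (rem i s))] were 0, the exchange would keep the value [c] and lower the sum of
     roots. *)
  have [[t ti /(smin_rem i t si)[+ eqt]]|Ar] := exchange_down _ _ Ai pos.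
    have it0 : 0 < i%:R - t%:R :> R by rewrite subr_gt0 ltr_nat.
    rewrite pmulr_rge0 // => ?; split=> // Li.
    by move: eqt; rewrite Li mulr0 leqNgt ti => /(_ erefl).
  have [|L0 Lx] := H2 _ Ar; first by rewrite size_rem // ss.
  by split=> // Li; have := LX i si; rewrite Lx // Li mulr0 addr0.
have [N [sN bigN]] : exists N, (forall i, i \in s -> (i < N)%N) /\
    forall i, i \in s -> 0 < L (rootpoly (rem i s)) ->
      c <= (N%:R - i%:R) * L (rootpoly (rem i s)).
  have [B sB] : exists B, forall i, i \in s -> 0 < L (rootpoly (rem i s)) ->
      c / L (rootpoly (rem i s)) + i%:R <= B%:R.
    exists (\sum_(i <- s) Num.bound (c / L (rootpoly (rem i s)) + i%:R)).
    move=> i si Li; have pos : 0 <= c / L (rootpoly (rem i s)) + i%:R.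
      by rewrite addr_ge0 // divr_ge0 // ltW.
    apply: le_trans (ltW (archi_boundP pos)) _.
    by rewrite ler_nat (bigD1_seq i) //= leq_addr.
  exists (B + sumn s).+1; split=> [i si|i si Li].
    by rewrite ltnNge; apply: contraL si => ?; apply: notin_sumn; lia.
  rewrite -ler_pdivrMr // lerBrDr (le_trans (sB i si Li)) // ler_nat.
  by rewrite -addnS leq_addr.
have NS : N \notin s by apply/negP => /sN; rewrite ltnn.
(* Lagrange weights at the nodes; the value 0 elsewhere keeps the weight function nonnegative. *)
exists (N :: s), (fun y => if y \in N :: s then
  L (rootpoly (rem y (N :: s))) / (rootpoly (rem y (N :: s))).[y%:R] else 0).
split=> [y|f sf]; last first.
  rewrite {1}(lagrange (N :: s) f) ?raddf_sum /= ?NS ?ss //.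
  rewrite big_seq [RHS]big_seq; apply: eq_bigr => y ys.
  by rewrite ys linearZ /= mulrC mulrA mulrAC.
case: ifP => //; rewrite inE => /orP[/eqP ->|ys].
  by rewrite /= eqxx divr_ge0 //; case: As.
have yN : y != N by apply: contraNneq NS => <-.
rewrite /= eq_sym (negPf yN) Ladd LX // horner_rootpoly_cons.
have yN0 : y%:R - N%:R < 0 :> R by rewrite subr_lt0 ltr_nat sN.
(* With [R = rootpoly (rem y s)], the weight is [c - (N - y) L(R)] over [(y - N) R(y)]. Both are
   nonnegative if [R(y) < 0]; otherwise both are nonpositive, by the choice of [N] or because
   [c = 0]. *)
have [[neg Lneg]|[pos [Lpos Lc]]] := sign y ys.
  rewrite divr_ge0 // ?mulr_le0 ?(ltW neg) ?(ltW yN0) //; nra.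
have num : c + y%:R * L (rootpoly (rem y s)) - N%:R * L (rootpoly (rem y s)) <= 0.
  have := Lpos; rewrite le_eqVlt => /orP[/eqP /esym L0|/(bigN y ys)]; last by lra.
  by rewrite Lc // L0 !mulr0 add0r subrr.
by rewrite -mulrNN -invrN mulr_ge0 ?oppr_ge0 // invr_ge0 -mulNr mulr_ge0 ?ltW // oppr_gt0.
Qed.

Lemma moment_conditions_atomic n : L 1 = 1 -> moment_conditions n -> atomic n.
Proof.
move=> L1; have atomic0 : atomic 0.
  exists [:: 0%N], (fun=> 1); split=> // f sf.
  rewrite big_seq1 mul1r (size1_polyC sf) hornerC.
  by rewrite -[_%:P]mulr1 mul_polyC linearZ /= L1 mulr1.
case: n => // n; elim: n => [|n ih] Hn; apply: atomic_succ => //.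
exact/ih/moment_conditions_pred.
Qed.

End Moments.

(** * Translation to moment vectors and measures *)

Lemma calPE (R : realType) k (P : {poly R}) :
  calP k P <-> exists s, [/\ admissible (R := R) s, size s = k & P = rootpoly s].
Proof.
split=> [[Pm sP [s [us ss rs]] P0]|[s [[us s0] <- ->]]]; last first.
  split; [exact: monic_rootpoly|exact: size_rootpoly| |exact: s0].
  by exists s; split=> //; apply/allP => j js; rewrite /root rootpoly_eq0.
have Ps : P = rootpoly s.
  rewrite (all_roots_prod_XsubC (rs := [seq j%:R | j <- s]) (p := P)).
  - by rewrite (monicP Pm) scale1r big_map.
  - by rewrite size_map ss.
  - by rewrite all_map.
  rewrite uniq_rootsE map_inj_uniq // => x y /eqP.
  by rewrite eqr_nat => /eqP.
by exists s; split=> //; split=> // x; rewrite -Ps.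
Qed.

Section MomentFunctional.
Context {R : realType} {n : nat}.
Variable m : n.-tuple R.

(** [momentL] with the polynomial as last argument, so that it can carry a linear structure. *)
Definition moment_functional (P : {poly R}) : R := momentL P m.

Lemma moment_functional_is_linear : scalar moment_functional.
Proof.
move=> a P Q; rewrite /moment_functional /momentL mulr_sumr -big_split /=.
by apply: eq_bigr => i _; rewrite coefD coefZ mulrDl mulrA.
Qed.

HB.instance Definition _ :=
  GRing.isLinear.Build R {poly R} R *%R moment_functional moment_functional_is_linear.

Lemma moment_functionalXn k : (k <= n)%N -> moment_functional 'X^k = moment m k.
Proof.
move=> kn; rewrite /moment_functional /momentL (bigD1 (Ordinal (kn : (k < n.+1)%N))) //=.
rewrite big1 ?addr0 => [|i ik]; first by rewrite coefXn eqxx mul1r.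
by rewrite coefXn -(inj_eq val_inj) /= in ik *; rewrite (negPf ik) mul0r.
Qed.

Lemma moment_functional1 : moment_functional 1 = 1.
Proof. by rewrite -(expr0 'X) moment_functionalXn. Qed.

End MomentFunctional.

Lemma measurable_fun_nat d (U : measurableType d) (f : nat -> U) :
  measurable_fun setT f.
Proof. by []. Qed.

Section FiniteProbability.
Context {R : realType}.
Variables (s : seq nat) (w : nat -> {nonneg R}).
Hypothesis w1 : \sum_(y <- s) (w y)%:num = 1.

(* The proof is an argument because the canonical instance depends on it. *)
Definition finite_probability of \sum_(y <- s) (w y)%:num = 1 :
    set nat -> \bar R :=
  msum (fun i => mscale (w (nth 0 s i)) \d_(nth 0 s i)) (size s).

HB.instance Definition _ := Measure.on (finite_probability w1).

Lemma integral_finite_probability (f : nat -> R) : (forall x, 0 <= f x) ->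
  (\int[finite_probability w1]_(x in setT) (f x)%:E)%E =
  (\sum_(y <- s) (w y)%:num * f y)%:E.
Proof.
move=> f0; rewrite ge0_integral_measure_sum //; last by move=> x _; rewrite lee_fin.
rewrite (big_nth 0) big_mkord -sumEFin; apply: eq_bigr => i _.
rewrite ge0_integral_mscale //; last by move=> x _; rewrite lee_fin.
by rewrite integral_dirac // diracT mul1e.
Qed.

Let finite_probability_setT : finite_probability w1 setT = 1%E.
Proof.
rewrite -[LHS]mul1e -integral_cst // integral_finite_probability //.
by under eq_bigr do rewrite mulr1; rewrite w1.
Qed.

HB.instance Definition _ :=
  Measure_isProbability.Build _ _ _ (finite_probability w1) finite_probability_setT.

End FiniteProbability.

(** * Realizability: sufficiency of atomic representations, and necessity *)

Section Realizable.
Context {R : realType} {n : nat}.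
Variable m : n.-tuple R.

Lemma atomic_realizable : atomic (moment_functional m) n -> realizable m.
Proof.
move=> [s [w [w0 ws]]].
pose u y := NngNum (w0 y).
(* Exactness on the constant 1 gives total mass 1. *)
have u1 : \sum_(y <- s) (u y)%:num = 1.
  rewrite -(moment_functional1 m) ws ?size_poly1 //.
  by apply: eq_bigr => y _; rewrite hornerC mulr1.
exists (finite_probability s u u1 : probability nat R) => k /andP[_ kn].
rewrite integral_finite_probability => [|x]; last exact: exprn_ge0.
rewrite -moment_functionalXn // ws ?size_polyXn //.
by under [in RHS]eq_bigr do rewrite hornerXn.
Qed.

Section Necessity.
Variable mu : probability nat R.
Hypothesis mu_moments : forall k : nat, (1 <= k <= n)%N ->
  (\int[mu]_(x in [set: nat]) ((x%:R : R) ^+ k)%:E)%E = (moment m k)%:E.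

Lemma integral_horner (P : {poly R}) : (size P <= n.+1)%N ->
  (\int[mu]_(x in setT) (P.[x%:R])%:E)%E = (momentL P m)%:E.
Proof.
move=> sP.
(* Order 0 is not covered by [mu_moments]; it is the total mass. *)
have pow (k : 'I_n.+1) : (\int[mu]_(x in [set: nat]) ((x%:R : R) ^+ k)%:E)%E = (moment m k)%:E.
  have [-> |k0] := posnP k; last by rewrite mu_moments // k0 -ltnS ltn_ord.
  by under eq_integral do rewrite expr0; rewrite integral_cst // mul1e; exact: probability_setT.
have ipow (k : 'I_n.+1) : mu.-integrable setT (fun x => ((x%:R : R) ^+ k)%:E).
  apply/integrableP; split=> //.
  under eq_integral do rewrite gee0_abs ?lee_fin ?exprn_ge0 //.
  by rewrite pow ltry.
under eq_integral do rewrite (horner_coef_wide _ sP) -sumEFin.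
rewrite integral_sum // => [|k]; last first.
  by under eq_fun do rewrite EFinM; exact: integrableZl.
rewrite /momentL -sumEFin; apply: eq_bigr => k _.
under eq_integral do rewrite EFinM.
by rewrite integralZl // pow.
Qed.

Lemma momentL_ge0 (P : {poly R}) : (size P <= n.+1)%N ->
  (forall x : nat, 0 <= P.[x%:R]) -> 0 <= momentL P m.
Proof.
move=> sP P0; rewrite -lee_fin -integral_horner //.
by apply: integral_ge0 => x _; rewrite lee_fin.
Qed.

Lemma momentL_hatpoly_eq0 (P : {poly R}) : (size P <= n)%N ->
  (forall x : nat, 0 <= P.[x%:R]) -> momentL P m = 0 -> momentL (hatpoly P) m = 0.
Proof.
move=> sP P0 LP0; apply: EFin_inj.
rewrite -integral_horner; last by rewrite /hatpoly mulrC (leq_trans (size_polyMleq _ _)) ?size_polyX //= addn2.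
have P_ae0 : ae_eq mu setT (fun x : nat => (P.[x%:R])%:E) (cst 0%E).
  apply/ae_eq_integral_abs => //.
  under eq_integral do rewrite gee0_abs ?lee_fin //.
  by rewrite integral_horner ?LP0 // leqW.
rewrite (@ae_eq_integral _ _ _ mu setT (cst 0%E)) ?integral0 //.
apply: filterS P_ae0 => x /= /(_ I)[Px] _.
by rewrite /hatpoly hornerM Px mulr0.
Qed.

End Necessity.
End Realizable.

Theorem theorem3p1 (R : realType) (n : nat) (hn : (1 <= n)%N) (m : n.-tuple R) :
  realizable m <->
  ((forall P : {poly R}, calP n P -> 0 <= momentL P m) /\
   (forall P : {poly R}, calP n.-1 P ->
      0 <= momentL P m /\ (momentL P m = 0 -> momentL (hatpoly P) m = 0))).
Proof.
split=> [[mu mum]|[H1 H2]].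
  split=> P [_ sP _ P0]; first by apply: (momentL_ge0 m mu mum) => //; rewrite sP.
  rewrite prednK // in sP; split.
    by apply: (momentL_ge0 m mu mum) => //; rewrite sP leqW.
  by apply: (momentL_hatpoly_eq0 m mu mum) => //; rewrite sP.
apply/atomic_realizable/moment_conditions_atomic; first exact: moment_functional1.
split=> s As ss; first by apply: H1; apply/calPE; exists s.
by apply: H2; apply/calPE; exists s.
Qed.
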